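(* Let $A=(A_{ij})\in\mathbb{R}_{\min}^{n\times n}$ be irreducible, let $a=(a_{ij})\in\mathbb{C}^{n\times n}$, and let $\mathcal{A}\in\mathcal{C}^{n\times n}$ satisfy $(\mathcal{A}_\epsilon)_{ij}\simeq a_{ij}\epsilon^{A_{ij}}$ for all $i,j$. Assume that the eigenvalues $\mathcal{L}^1_\epsilon,\ldots,\mathcal{L}^n_\epsilon$ of $\mathcal{A}_\epsilon$ (counted with multiplicities) have first order asymptotics $\mathcal{L}^i_\epsilon\sim\lambda_i\epsilon^{\Lambda_i}$, and denote by $\Lambda=(\Lambda_1\leq\cdots\leq\Lambda_n)$ the sequence of their exponents (counted with multiplicities). Let $\Gamma=(\gamma_1\leq\cdots\leq\gamma_n)$ be the sequence of roots of the min-plus characteristic polynomial of $A$. Then $$\Lambda\prec^{\rm w}\Gamma ,$$ and, for generic values of $a=(a_{ij})\in\mathbb{C}^{n\times n}$, $\Lambda=\Gamma$.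
   Context: The min-plus semiring $\mathbb{R}_{\min}$ is $\mathbb{R}\cup\{+\infty\}$ with addition $a\oplus b=\min(a,b)$ and multiplication $ab=a+b$ (zero element $+\infty$, unit $0$). A matrix $A\in\mathbb{R}_{\min}^{n\times n}$ is irreducible if the digraph with nodes $1,\ldots,n$ and an arc $(i,j)$ whenever $A_{ij}\neq+\infty$ is strongly connected. $\mathcal{C}$ is the ring of germs at $0$ of continuous functions $f:(0,\epsilon_0)\to\mathbb{C}$ ($\epsilon_0>0$) such that $|f(\epsilon)|\leq\epsilon^{-k}$ on $(0,\epsilon_0)$ for some positive constant $k$. For $f\in\mathcal{C}$, $b\in\mathbb{C}$, $B\in\mathbb{R}_{\min}$: $f(\epsilon)\simeq b\epsilon^B$ means $\lim_{\epsilon\to0}\epsilon^{-B}f(\epsilon)=b$ if $B\in\mathbb{R}$, and means $f=0$ (near $0$) if $B=+\infty$. A function $f\in\mathcal{C}$ has first order asymptotics $f(\epsilon)\sim b\epsilon^B$ if either $B\in\mathbb{R}$, $b\in\mathbb{C}\setminus\{0\}$ and $\lim_{\epsilon\to0}\epsilon^{-B}f(\epsilon)=b$, or $B=+\infty$ and $f=0$ near $0$; $B$ is its exponent. The eigenvalues $\mathcal{L}^i$ are elements of $\mathcal{C}$ giving, for all small $\epsilon$, the eigenvalues of $\mathcal{A}_\epsilon$ counted with multiplicities. The min-plus characteristic polynomial of $A$ is $P=\bigoplus_{j=0}^n P_j\mathsf{Y}^j$ with $P_n=0$ (the unit) and, for $1\le k\le n$, $P_{n-k}=\min_{J\subset\{1,\ldots,n\},\,\#J=k}\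 \min_{\sigma\in\mathfrak{S}_J}\sum_{j\in J}A_{j\sigma(j)}$, where $\mathfrak{S}_J$ is the set of permutations of $J$ (it is the min-plus permanent of $\mathsf{Y}I\oplus A$). The roots of a formal min-plus polynomial $P$ of degree $n$ are the unique $c_1\leq\cdots\leq c_n$ in $\mathbb{R}\cup\{+\infty\}$ such that $\min_{k}(P_k+ky)=P_n+\sum_{i=1}^n\min(y,c_i)$ for all $y$. For $u,v\in\mathbb{R}_{\min}^n$ with components in increasing order $u_{(1)}\leq\cdots\leq u_{(n)}$, $v_{(1)}\leq\cdots\leq v_{(n)}$, $u\prec^{\rm w}v$ ($u$ is weakly (super) majorised by $v$) means $u_{(1)}+\cdots+u_{(k)}\geq v_{(1)}+\cdots+v_{(k)}$ for all $k=1,\ldots,n$. A property holds for generic values of $a$ if the set of $a\in\mathbb{C}^{n\times n}$ for which it fails is contained in a proper algebraic subset, i.e. there is a nonzero polynomial $R$ in $n^2$ variables such that the property holds whenever $R(a)\neq0$. Here $A$ is fixed, and the property is required for every $\mathcal{A}$ as in the claim with this $a$ and $A$ ($R$ depends only on $A$). *)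

(* Defs.v *)
From mathcomp Require Import all_boot all_order all_fingroup all_algebra.
From mathcomp Require Import all_classical all_reals all_analysis.
From mathcomp Require Import complex.
From mathcomp Require mpoly.
(* The notations of mpoly clash with those of mathcomp-analysis. *)
Import (canonicals) mpoly.
Import Order.TTheory GRing.Theory Num.Theory numFieldNormedType.Exports.

Set Implicit Arguments.
Unset Strict Implicit.
Unset Printing Implicit Defensive.

Local Open Scope classical_set_scope.
Local Open Scope ring_scope.

(* The min-plus semiring R u {+oo} is represented inside \bar R: the tropical
   sum is Order.min, with neutral element +oo, the tropical product is the
   addition of \bar R, and the tropical power y^k is (y *+ k)%E.  The value
   -oo is excluded by the predicate [minplus]. *)
Definition minplus (R : realType) (x : \bar R) : Prop := x != -oo%E.

Definition minplus_mx (R : realType) (n : nat) (A : 'M[\bar R]_n) : Prop :=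
  forall i j, minplus (A i j).

(* [connect] is the reflexive transitive closure of the arc relation. *)
Definition minplus_irreducible (R : realType) (n : nat)
    (A : 'M[\bar R]_n) : Prop :=
  forall i j : 'I_n, connect [rel k l | A k l != +oo%E] i j.

(* Coefficient of Y^j in the min-plus permanent of Y I (+) A, for j <= n: the
   minimum runs over the subsets J with n - j elements and over the
   permutations of J, seen as the permutations of 'I_n supported in J.
   For j = n only J = set0 and the identity remain, and the value is 0. *)
Definition minplus_char_coef (R : realType) (n : nat) (A : 'M[\bar R]_n)
    (j : nat) : \bar R :=
  \big[Order.min/+oo%E]_(J : {set 'I_n} | #|J| == (n - j)%N)
    \big[Order.min/+oo%E]_(s : {perm 'I_n} | perm_on J s)
      (\sum_(i in J) A i (s i))%E.

(* c is the nondecreasing sequence of roots of the formal min-plus polynomial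
   of degree n with coefficients P 0, ..., P n. *)
Definition minplus_roots (R : realType) (n : nat) (P : nat -> \bar R)
    (c : n.-tuple (\bar R)) : Prop :=
  [/\ sorted <=%O c,
      forall i : 'I_n, minplus (tnth c i) &
      forall y : \bar R, minplus y ->
        \big[Order.min/+oo%E]_(k < n.+1) (P k + y *+ k)%E =
        (P n + \sum_(i < n) Order.min y (tnth c i))%E].

(* Weak (super)majorisation u <^w v. *)
Definition weak_supermajorized (R : realType) (n : nat)
    (u v : n.-tuple (\bar R)) : Prop :=
  forall k : nat, (1 <= k <= n)%N ->
    (\sum_(x <- take k (sort <=%O v)) x <=
     \sum_(x <- take k (sort <=%O u)) x)%E.

(* f represents an element of the ring C of germs at 0 (to the right). *)
Definition in_germ_ring (R : realType) (f : R -> R[i]) : Prop :=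
  exists2 e0 : R, 0 < e0 &
    (forall e, 0 < e < e0 -> {for e, continuous (f : R -> R[i]^o)}) /\
    (exists2 k : R, 0 < k &
       forall e, 0 < e < e0 -> `|f e| <= (e `^ (- k))%:C%C).

(* f(eps) ~= b eps^B. *)
Definition asymp_equiv (R : realType) (f : R -> R[i]) (b : R[i])
    (B : \bar R) : Prop :=
  match B with
  | EFin r =>
      ((e `^ (- r))%:C%C * f e : R[i]^o) @[e --> (0 : R)^'+] --> (b : R[i]^o)
  | +oo%E => \forall e \near (0 : R)^'+, f e = 0
  | -oo%E => False
  end.

(* f(eps) ~ b eps^B; for B = +oo there is no condition on b. *)
Definition first_order_asymp (R : realType) (f : R -> R[i]) (b : R[i])
    (B : \bar R) : Prop :=
  [/\ in_germ_ring f, B != +oo%E -> b != 0 & asymp_equiv f b B].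

(* mA lies in C^(n x n) and (mA_eps)_ij ~= a_ij eps^(A_ij). *)
Definition mx_asymp (R : realType) (n : nat) (mA : R -> 'M[R[i]]_n)
    (a : 'M[R[i]]_n) (A : 'M[\bar R]_n) : Prop :=
  forall i j, in_germ_ring (fun e => mA e i j) /\
              asymp_equiv (fun e => mA e i j) (a i j) (A i j).

(* For all small eps > 0, L_1(eps), ..., L_n(eps) are the eigenvalues of
   mA_eps counted with (algebraic) multiplicities. *)
Definition eigenvalue_germs (R : realType) (n : nat) (mA : R -> 'M[R[i]]_n)
    (L : 'I_n -> R -> R[i]) : Prop :=
  (forall i, in_germ_ring (L i)) /\
  \forall e \near (0 : R)^'+,
    char_poly (mA e) = \prod_(i < n) ('X - (L i e)%:P).

(* [mxvec] lists the n * n entries of a as the values of the variables. *)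
Definition generically (R : realType) (n : nat)
    (Q : 'M[R[i]]_n -> Prop) : Prop :=
  exists2 p : mpoly.mpoly (n * n) R[i], p != 0 &
    forall a : 'M[R[i]]_n,
      mpoly.meval (fun k => mxvec a ord0 k) p != 0 -> Q a.

(* Main.v *)
Require Import Defs.
From mathcomp Require Import all_boot all_order all_fingroup all_algebra.
From mathcomp Require Import all_classical all_reals all_analysis.
From mathcomp Require Import complex lra.
From mathcomp Require mpoly.
Import (canonicals) mpoly.
Import Order.TTheory GRing.Theory Num.Theory numFieldNormedType.Exports.
Local Open Scope ring_scope.

(** The min-plus polynomial function
      M(y) = min_k (P_k + k y) = sum_i min(y, gamma_i)
    and the function
      S(y) = sum_i min(y, Lambda_i)
    are compared for every real y by evaluating one function of eps,
      F(eps) = det (w eps^y I - mA_eps),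
    in two ways, w being a complex parameter.

    - Through the coefficients of the characteristic polynomial.  The
      coefficient of X^k is a signed sum, over the permutations s of the sets J
      with n - k elements, of products of entries of mA; it is therefore
      equivalent to q_k eps^(P_k), where q_k collects the terms of minimal
      weight.  Hence eps^(- M(y)) F(eps) tends to the value at w of the
      polynomial sum_k q_k w^k, restricted to the k attaining M(y)
      ([char_poly_horner_asymp]).

    - Through the eigenvalues.  F is the product of the w eps^y - L_i(eps), so
      eps^(- S(y)) F(eps) tends to the value at w of a product of polynomials
      of the form w, w - lambda_i or - lambda_i, none of which is the zero
      polynomial ([eigen_prod_asymp]).

    A w at which the second limit does not vanish shows M(y) <= S(y).  If the
    q_k with P_k finite do not vanish, then the first limit is not identically
    zero in w either and S(y) <= M(y) ([minplus_char_eval_le_exponents],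
    [exponents_le_minplus_char_eval]).  Each such q_k is a polynomial in the
    entries of a, and it is a nonzero polynomial because it takes the value 1
    or -1 at a partial permutation matrix ([char_coef_lead_neq0]); the
    genericity condition is that their product does not vanish.

    What remains is a statement about sequences: an inequality between two
    functions y |-> sum_i min(y, c_i) implies the one between the sums of the
    first k elements of the sorted sequences ([prefix_sum_le]).  Used once it gives the majorisation,
    and used in both directions the equality of the two sequences
    ([prefix_sum_inj]). *)

Set Implicit Arguments.
Unset Strict Implicit.
Unset Printing Implicit Defensive.

(** * Calculus of first order asymptotics *)

Section Asymptotics.
Variable R : realType.
Local Open Scope classical_set_scope.
Implicit Types (f g : R -> R[i]) (b c : R[i]) (B C : \bar R).

Lemma asymp_equiv_minplus f b B : asymp_equiv f b B -> B != -oo%E.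
Proof. by case: B. Qed.

Lemma asymp_equiv_near f g b B :
  asymp_equiv f b B ->
  (\forall e \near (0 : R)^'+, f e = g e) -> asymp_equiv g b B.
Proof.
move=> + fg; case: B => [s| |] //= fb.
- apply: cvg_trans fb; apply: near_eq_cvg.
  by near=> e; congr (_ * _); near: e.
- by near=> e; rewrite -(near fg e) //; near: e.
Unshelve. all: by end_near. Qed.

Lemma near0_asymp_equiv0 f (s : R) :
  (\forall e \near (0 : R)^'+, f e = 0) -> asymp_equiv f 0 s%:E.
Proof.
move=> f0; rewrite /asymp_equiv.
apply: (@cvg_trans _ (((fun=> 0) : R -> R[i]^o) @ (0 : R)^'+)); last exact: cvg_cst.
by apply: near_eq_cvg; near=> e; rewrite (near f0 e) ?mulr0.
Unshelve. all: by end_near. Qed.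

Lemma powRCD (e s t : R) : 0 < e ->
  (e `^ (s + t))%:C%C = (e `^ s)%:C%C * (e `^ t)%:C%C.
Proof.
by move=> e0; rewrite -rmorphM /= -powRD // (lt0r_neq0 e0) implybT.
Qed.

Lemma powR_asymp_equiv (s : R) b :
  asymp_equiv (fun e => b * (e `^ s)%:C%C) b s%:E.
Proof.
rewrite /asymp_equiv.
apply: (@cvg_trans _ (((fun=> b) : R -> R[i]^o) @ (0 : R)^'+)); last exact: cvg_cst.
apply: near_eq_cvg; near=> e.
have e0 : 0 < e by near: e; exact: nbhs_right_gt.
by rewrite mulrCA -powRCD // addNr powRr0 mulr1.
Unshelve. all: by end_near. Qed.

Lemma cst_asymp_equiv b : asymp_equiv (fun=> b : R[i]) b 0%E.
Proof.
apply: (asymp_equiv_near (@powR_asymp_equiv 0 b)).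
by near=> e; rewrite powRr0 mulr1.
Unshelve. all: by end_near. Qed.

Lemma powRC_cvg0 (s : R) : 0 < s ->
  ((e `^ s)%:C%C : R[i]^o) @[e --> (0 : R)^'+] --> (0 : R[i]^o).
Proof.
move=> s0; apply/cvgr0Pnorm_lt => -[d d'] /=; rewrite ltcE /= => /andP[/eqP -> d0].
have /cvgr0Pnorm_lt/(_ _ d0) h := powR_cvg0 s0.
apply: filterS h => e h; rewrite ltcE /= expr0n /= addr0 sqrtr_sqr eqxx /=.
exact: h.
Qed.

(** The extra factor [e `^ (t - s)] kills the limit; a germ that vanishes near 0
    has every real exponent, with coefficient 0. *)
Lemma asymp_equiv_lt f b B (s : R) :
  asymp_equiv f b B -> (s%:E < B)%E -> asymp_equiv f 0 s%:E.
Proof.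
case: B => [t| |] /= fb st; [| exact: near0_asymp_equiv0 fb | by []].
rewrite lte_fin in st.
have ts0 : 0 < t - s by rewrite subr_gt0.
have := cvgM (powRC_cvg0 ts0) fb; rewrite mul0r => fb0.
apply: cvg_trans (fb0 _).
apply: near_eq_cvg; near=> e.
have e0 : 0 < e by near: e; exact: nbhs_right_gt.
rewrite /= mulrA -powRCD //.
by rewrite addrAC subrr sub0r.
Unshelve. all: by end_near. Qed.

Lemma asymp_equivM f g b c B C :
  asymp_equiv f b B -> asymp_equiv g c C ->
  asymp_equiv (fun e => f e * g e) (b * c) (B + C)%E.
Proof.
case: B => [s| |] /= fb; last by case: fb.
- case: C => [t| |] /= gc; last by case: gc.
  + have fgbc := cvgM fb gc; apply: cvg_trans (fgbc _); apply: near_eq_cvg.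
    near=> e.
    have e0 : 0 < e by near: e; exact: nbhs_right_gt.
    by rewrite /= mulrACA -powRCD // opprD.
  + by near=> e; rewrite (near gc e) ?mulr0.
- case: C => [t| |] /= gc; last by case: gc.
  + by near=> e; rewrite (near fb e) ?mul0r.
  + by near=> e; rewrite (near fb e) ?mul0r.
Unshelve. all: by end_near. Qed.

Lemma asymp_equivN f b B :
  asymp_equiv f b B -> asymp_equiv (fun e => - f e) (- b) B.
Proof.
move=> fb; rewrite -[B]add0e -mulN1r.
apply: asymp_equiv_near (asymp_equivM (@cst_asymp_equiv (-1)) fb) _.
by near=> e; rewrite mulN1r.
Unshelve. all: by end_near. Qed.

Lemma asymp_equiv_prod (I : Type) (r : seq I) (P : pred I)
    (f : I -> R -> R[i]) (b : I -> R[i]) (B : I -> \bar R) :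
  (forall i, P i -> asymp_equiv (f i) (b i) (B i)) ->
  asymp_equiv (fun e => \prod_(i <- r | P i) f i e)
    (\prod_(i <- r | P i) b i) (\sum_(i <- r | P i) B i)%E.
Proof.
move=> fb; elim: r => [|i r IH].
  rewrite !big_nil; apply: (asymp_equiv_near (@cst_asymp_equiv 1)).
  by near=> e; rewrite big_nil.
rewrite !big_cons; case: (boolP (P i)) => Pi; last first.
  by apply: (asymp_equiv_near IH); near=> e; rewrite big_cons (negbTE Pi).
apply: (asymp_equiv_near (asymp_equivM (fb i Pi) IH)).
by near=> e; rewrite big_cons Pi.
Unshelve. all: by end_near. Qed.

Lemma asymp_equivX f b B k :
  asymp_equiv f b B -> asymp_equiv (fun e => f e ^+ k) (b ^+ k) (B *+ k)%E.
Proof.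
move=> fb; have := @asymp_equiv_prod _ (index_enum 'I_k) predT
  (fun=> f) (fun=> b) (fun=> B) (fun _ _ => fb).
rewrite prodr_const card_ord.
rewrite (_ : (\sum_(i < k) B)%E = (B *+ k)%E); last first.
  by elim: k => [|k IH]; rewrite ?big_ord0 // big_ord_recl IH muleS.
move=> /asymp_equiv_near; apply; near=> e.
by rewrite prodr_const card_ord.
Unshelve. all: by end_near. Qed.

Lemma asymp_equivD f g b c B :
  asymp_equiv f b B -> asymp_equiv g c B ->
  asymp_equiv (fun e => f e + g e) (b + c) B.
Proof.
case: B => [s| |] /= fb gc; last by case: fb.
- have fgbc := cvgD fb gc; apply: cvg_trans (fgbc _); apply: near_eq_cvg.
  by near=> e; rewrite mulrDr.
- by near=> e; rewrite (near fb e) ?(near gc e) ?addr0.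
Unshelve. all: by end_near. Qed.

Lemma asymp_equiv_le f b B C :
  asymp_equiv f b B -> C != -oo%E -> (C <= B)%E ->
  asymp_equiv f (if B == C then b else 0) C.
Proof.
move=> fb; case: C => [s _| _|//].
  rewrite le_eqVlt eq_sym; case: eqVneq => [<- //|_ /=].
  exact: asymp_equiv_lt fb.
by rewrite leye_eq => /eqP BE; rewrite BE eqxx -BE.
Qed.

(** Only the terms whose exponent equals the lower bound [C] contribute to the
    coefficient.  The bound need not be attained, in which case the coefficient
    is 0. *)
Lemma asymp_equiv_sum (I : Type) (r : seq I) (P : pred I)
    (f : I -> R -> R[i]) (b : I -> R[i]) (B : I -> \bar R) C :
  C != -oo%E ->
  (forall i, P i -> asymp_equiv (f i) (b i) (B i)) ->
  (forall i, P i -> (C <= B i)%E) ->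
  asymp_equiv (fun e => \sum_(i <- r | P i) f i e)
    (\sum_(i <- r | P i && (B i == C)) b i) C.
Proof.
move=> Cfin fb BC; rewrite big_mkcondr /=; elim: r => [|i r IH].
  rewrite big_nil.
  have h : \forall e \near (0:R)^'+, \sum_(i <- [::] | P i) f i e = 0.
    by near=> e; rewrite big_nil.
  by case: C {BC} Cfin => // s _; exact: near0_asymp_equiv0.
rewrite big_cons; case: (boolP (P i)) => Pi; last first.
  by apply: (asymp_equiv_near IH); near=> e; rewrite big_cons (negbTE Pi).
have fbC := asymp_equiv_le (fb i Pi) Cfin (BC i Pi).
apply: (asymp_equiv_near (asymp_equivD fbC IH) _).
by near=> e; rewrite big_cons Pi.
Unshelve. all: by end_near. Qed.

(** The exponent of a germ with a nonzero coefficient is the largest one the germ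
    admits.  All the inequalities between exponents come from this lemma, with
    two expressions of the same germ. *)
Lemma asymp_equiv_exponent_le f b c B C :
  asymp_equiv f b B -> asymp_equiv f c C -> c != 0 -> C != +oo%E ->
  (B <= C)%E.
Proof.
move=> fb fc c0 Cfin; rewrite leNgt; apply/negP => CB.
case: C Cfin fc CB => // s _ fc sB.
have f0 := asymp_equiv_lt fb sB.
by move: c0; rewrite (cvg_unique _ fc f0) ?eqxx //; exact: norm_hausdorff.
Qed.
End Asymptotics.

(** * Sums of minima and sums of smallest elements *)

Section Majorisation.
Variable R : realType.
Local Open Scope ereal_scope.
Implicit Types (s u v : seq (\bar R)) (y : R).

Lemma sum_min_le_mulrn y s : \sum_(x <- s) Order.min y%:E x <= y%:E *+ size s.
Proof.
elim: s => [|x s IH]; first by rewrite big_nil.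
by rewrite big_cons muleS leeD // ge_min lexx.
Qed.

Lemma sum_min_ge y s : all (fun x => y%:E <= x) s ->
  \sum_(x <- s) Order.min y%:E x = y%:E *+ size s.
Proof.
elim: s => [|x s IH]; first by rewrite big_nil.
by rewrite big_cons muleS => /= /andP[yx ys]; rewrite IH // min_l.
Qed.

(** When [y] is below the elements of [drop k v], each of them contributes [y] on
    the left, while the elements of [drop k u] contribute at most [y]: the tails
    cancel. *)
Lemma prefix_sum_min_le u v k y :
  size u = size v -> all (fun x => y%:E <= x) (drop k v) ->
  \sum_(x <- v) Order.min y%:E x <= \sum_(x <- u) Order.min y%:E x ->
  \sum_(x <- take k v) Order.min y%:E x <= \sum_(x <- take k u) x.
Proof.
move=> uv yv; rewrite -{1}(cat_take_drop k v) -{1}(cat_take_drop k u).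
rewrite !big_cat /= (sum_min_ge yv) => le_vu.
have fin : y%:E *+ size (drop k v) \is a fin_num by rewrite -EFin_natmul.
rewrite -(leeD2rE _ _ fin); apply: le_trans le_vu _; apply: leeD.
  by apply: lee_sum => x _; rewrite ge_min lexx orbT.
by apply: le_trans (sum_min_le_mulrn _ _) _; rewrite !size_drop uv.
Qed.

Lemma sum_min_fin_num y s : -oo \notin s ->
  \sum_(x <- s) Order.min y%:E x \is a fin_num.
Proof.
elim: s => [|x s IH]; first by rewrite big_nil.
rewrite inE negb_or big_cons => /andP[xoo soo]; rewrite fin_numD IH // andbT.
by case: x xoo => [r| |] // _; rewrite minEle ?leey //; case: ifP.
Qed.

(** The test value is the largest element [x0] among the first [k] of [v]: up to
    [y = x0] the previous lemma applies, and at [y = x0] the minima on its left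
    are the elements themselves.  If [x0] is infinite, [y] tends to infinity
    instead, and the sum of the first [k] elements of [u] has to be infinite. *)
Lemma prefix_sum_le u v k :
  sorted <=%O v -> -oo \notin v -> size u = size v -> (k <= size v)%N ->
  (forall y, \sum_(x <- v) Order.min y%:E x <= \sum_(x <- u) Order.min y%:E x) ->
  \sum_(x <- take k v) x <= \sum_(x <- take k u) x.
Proof.
move=> sv voo uv kv le_vu; case: k kv => [|j] jv.
  by rewrite !take0 !big_nil.
set x0 := nth +oo v j.
have tj : take j.+1 v = rcons (take j v) x0 by rewrite -take_nth.
have nthv i1 i2 : (i1 <= i2)%N -> (i2 < size v)%N -> nth +oo v i1 <= nth +oo v i2.
  move=> i12 i2v; apply: (sorted_leq_nth le_trans lexx +oo sv) => //.
  by rewrite inE (leq_ltn_trans i12).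
have key y : y%:E <= x0 ->
    \sum_(x <- take j.+1 v) Order.min y%:E x <= \sum_(x <- take j.+1 u) x.
  move=> yx0; apply: prefix_sum_min_le => //.
  apply/(all_nthP +oo) => i; rewrite size_drop nth_drop => ilt.
  apply: le_trans yx0 _; apply: nthv; first by rewrite addSn ltnW // ltnS leq_addr.
  by rewrite -ltn_subRL.
have x0v : x0 \in v by exact: mem_nth.
case E: x0 => [y| |]; last by move: voo; rewrite -E x0v.
- apply: le_trans (key y _); last by rewrite E.
  rewrite big_seq [leRHS]big_seq; apply: lee_sum => x /(nthP +oo)[k].
  rewrite size_takel // => kj <-; rewrite nth_take // le_min lexx andbT -E.
  exact: nthv.
- have := sum_min_fin_num 0 (s := take j v) _.
  set C := \sum_(x <- _) _ => Cfin.
  have CU y : (0 <= y)%R -> C + y%:E <= \sum_(x <- take j.+1 u) x.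
    move=> y0; apply: le_trans (key y _); last by rewrite E leey.
    rewrite tj big_rcons /= E [Order.min _ +oo]min_l ?leey // leeD2r //.
    apply: lee_sum => x _; rewrite le_min !ge_min lexx orbT andbT.
    by rewrite lee_fin y0.
  have {}Cfin : C \is a fin_num.
    by apply: Cfin; apply: contra voo; exact: mem_take.
  move: CU; rewrite -(fineK Cfin).
  case: (\sum_(x <- take j.+1 u) x) => [r| |] CU; first last.
  + by have := CU 0%R (lexx _); rewrite -EFinD leeNy_eq.
  + exact: leey.
  (* This value of y makes C + y exceed the finite bound r. *)
  have := CU `|r - fine C + 1|%R (normr_ge0 _); rewrite -EFinD lee_fin => h.
  by exfalso; move: h (ler_norm (r - fine C + 1)%R); lra.
Qed.

(** A finite head can be cancelled; after an infinite one, monotonicity leaves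
    only infinite elements, although the sums no longer tell them apart. *)
Lemma prefix_sum_inj u v :
  sorted <=%O u -> sorted <=%O v -> -oo \notin u -> -oo \notin v ->
  size u = size v ->
  (forall k, (k <= size v)%N -> \sum_(x <- take k v) x = \sum_(x <- take k u) x) ->
  u = v.
Proof.
elim: u v => [|x u IH] [|z v] //= su sv.
rewrite !inE !negb_or => /andP[xoo uoo] /andP[zoo voo] [uv] sumE.
have xz : z = x by have := sumE 1%N isT; rewrite /= !take0 !big_cons !big_nil !adde0.
subst z; congr cons; case: (eqVneq x +oo) => [xE|xfin].
  have inf w : path <=%O x w -> w = nseq (size w) +oo.
    move=> /(order_path_min le_trans) /allP h; apply/all_pred1P/allP => z zw.
    by have := h z zw; rewrite xE leye_eq.
  by rewrite (inf u su) (inf v sv) uv.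
apply: IH => //; [exact: path_sorted su | exact: path_sorted sv |].
move=> k kv; have := sumE k.+1 kv; rewrite /= !big_cons => h.
have xf : x \is a fin_num by rewrite fin_numE xoo.
by apply: le_anti; rewrite -(leeD2lE _ _ xf) h lexx -(leeD2lE _ _ xf) h lexx.
Qed.
End Majorisation.

(** * Coefficients of the characteristic polynomial *)

Section CharPolyCoef.
Variables (F : comNzRingType) (n : nat).
Implicit Types (M : 'M[F]_n) (J : {set 'I_n}) (s : {perm 'I_n}).

(** Outside of [J] the factor is the diagonal ['X] or an off-diagonal 0, so the
    product survives exactly when [s] fixes the complement of [J]. *)
Lemma prod_char_poly_mx M s J :
  \prod_i (if i \in J then - (M i (s i))%:P else ('X *+ (i == s i)) : {poly F})
  = if perm_on J s then (\prod_(i in J) - M i (s i))%:P * 'X^(n - #|J|) else 0.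
Proof.
case: ifPn => [/fintype.subsetP sJ | /fintype.subsetPn[j sj jJ]]; last first.
  by rewrite (bigD1 j) //= (negbTE jJ) eq_sym (negbTE sj) mulr0n mul0r.
rewrite (bigID (mem J)) /= rmorph_prod /=; congr (_ * _).
  by apply: eq_bigr => i iJ; rewrite iJ rmorphN.
have -> : (n - #|J|)%N = #|~: J| by rewrite [RHS]cardsCs finset.setCK card_ord.
rewrite -prodr_const; apply: eq_big => [i|i iJ]; first by rewrite !inE.
rewrite (negbTE iJ) (_ : i == s i) //; apply: contraNT iJ.
by rewrite eq_sym; apply: sJ.
Qed.

Lemma char_poly_expand M :
  char_poly M = \sum_J \sum_(s | perm_on J s)
    ((-1) ^+ s * \prod_(i in J) - M i (s i)) *: 'X^(n - #|J|).
Proof.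
rewrite (exchange_big_dep predT) //=; apply: eq_bigr => s _.
have -> : \prod_i char_poly_mx M i (s i) =
    \prod_i (- (M i (s i))%:P + 'X *+ (i == s i)).
  by apply: eq_bigr => i _; rewrite !mxE addrC.
rewrite bigA_distr mulr_sumr [RHS]big_mkcond; apply: eq_bigr => J _.
rewrite prod_char_poly_mx; case: ifP => _; last by rewrite mulr0.
by rewrite -mul_polyC rmorphM /= rmorph_sign mulrA.
Qed.

Lemma coef_char_poly M k : (k <= n)%N ->
  (char_poly M)`_k = \sum_(J : {set 'I_n} | #|J| == (n - k)%N)
    \sum_(s : {perm 'I_n} | perm_on J s) (-1) ^+ s * \prod_(i in J) - M i (s i).
Proof.
move=> kn; rewrite char_poly_expand coef_sum [RHS]big_mkcond.
apply: eq_bigr => J _; rewrite coef_sum.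
have Jn : (#|J| <= n)%N by rewrite -[n in (_ <= n)%N]card_ord max_card.
have -> : (#|J| == (n - k)%N) = (k == (n - #|J|)%N).
  by apply/eqP/eqP => ->; rewrite subKn.
case: eqVneq => kJ; last first.
  by apply: big1 => s _; rewrite coefZ coefXn (negbTE kJ) mulr0.
by apply: eq_bigr => s _; rewrite coefZ coefXn kJ eqxx mulr1.
Qed.
End CharPolyCoef.

(** * Minimal weights and the coefficients attached to them *)

Lemma bigmin_attained (d : Order.disp_t) (T : orderType d) (I : Type) (r : seq I)
    (P : pred I) (F : I -> T) (x : T) :
  \big[Order.min/x]_(i <- r | P i) F i != x ->
  exists2 i, P i & \big[Order.min/x]_(i <- r | P i) F i = F i.
Proof.
elim/big_ind: _ => [|a b IHa IHb|j Pj _]; rewrite ?eqxx //; last by exists j.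
by case: leP => _; [exact: IHa | exact: IHb].
Qed.

Section LeadingCoef.
Variables (R : realType) (n : nat) (A : 'M[\bar R]_n).

(** The part of minimal weight of the expansion [coef_char_poly].  It is defined
    over any ring in order to be used both for complex matrices and for the
    matrix of indeterminates. *)
Definition char_coef_lead (F : comNzRingType) (a : 'M[F]_n) (k : nat) : F :=
  \sum_(J : {set 'I_n} | #|J| == (n - k)%N)
    \sum_(s : {perm 'I_n} | perm_on J s &&
        ((\sum_(i in J) A i (s i))%E == minplus_char_coef A k))
      (-1) ^+ s * \prod_(i in J) - a i (s i).

Lemma rmorph_char_coef_lead (F G : comNzRingType) (f : {rmorphism F -> G})
    (a : 'M[F]_n) k :
  f (char_coef_lead a k) = char_coef_lead (map_mx f a) k.
Proof.
rewrite rmorph_sum; apply: eq_bigr => J _.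
rewrite rmorph_sum; apply: eq_bigr => s _.
rewrite rmorphM rmorph_sign rmorph_prod; congr (_ * _).
by apply: eq_bigr => i _; rewrite rmorphN mxE.
Qed.

Lemma minplus_char_coef_le k (J : {set 'I_n}) (s : {perm 'I_n}) :
  #|J| == (n - k)%N -> perm_on J s ->
  (minplus_char_coef A k <= \sum_(i in J) A i (s i))%E.
Proof.
move=> Jk sJ; apply: le_trans (bigmin_le_cond _ _ Jk) _.
exact: bigmin_le_cond.
Qed.

Lemma minplus_char_coef_attained k : minplus_char_coef A k != +oo%E ->
  exists J : {set 'I_n}, exists s : {perm 'I_n},
    [/\ #|J| == (n - k)%N, perm_on J s &
        (\sum_(i in J) A i (s i))%E = minplus_char_coef A k].
Proof.
move=> fin; have [J Jk E] := bigmin_attained fin.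
have fin' := fin; rewrite /minplus_char_coef E in fin'.
have [s sJ E'] := bigmin_attained fin'.
by exists J, s; rewrite /minplus_char_coef E E'.
Qed.

Lemma minplus_char_coef_fin k : minplus_mx A -> minplus_char_coef A k != -oo%E.
Proof.
move=> Afin; case: (eqVneq (minplus_char_coef A k) +oo%E) => [-> //|].
case/minplus_char_coef_attained => J [s [_ _ <-]].
rewrite esum_eqNy; apply/existsP => -[j /andP[_ E]].
by have := Afin j (s j); rewrite /minplus E.
Qed.

Lemma minplus_char_coef_n : minplus_char_coef A n = 0%E.
Proof.
rewrite /minplus_char_coef subnn (big_pred1 finset.set0); last first.
  by move=> J; rewrite cards_eq0.
rewrite (big_pred1 1%g) ?big_set0 // => s.
apply/idP/eqP => [/fintype.subsetP s0|->]; last exact: perm_on1.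
apply/permP => i; rewrite perm1; apply/eqP/negPn/negP => si.
by have := s0 i si; rewrite inE.
Qed.

(** At the matrix of a permutation [s0] of minimal weight, restricted to its set
    [J0], the only surviving term is the one of [J0] and [s0]: any other one
    contains a zero entry. *)
Lemma char_coef_lead_neq0 (F : comNzRingType) k :
  minplus_char_coef A k != +oo%E ->
  exists a : 'M[F]_n, char_coef_lead a k != 0.
Proof.
case/minplus_char_coef_attained => J0 [s0 [Jk sJ E]].
pose a : 'M[F]_n := \matrix_(i, j) ((i \in J0) && (j == s0 i))%:R.
exists a; rewrite /char_coef_lead (bigD1 J0) //= (bigD1 s0) /=; last first.
  by rewrite sJ E eqxx.
have prod0 (J : {set 'I_n}) (s : {perm 'I_n}) i :
    i \in J -> ~~ ((i \in J0) && (s i == s0 i)) ->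
    (-1) ^+ s * \prod_(i in J) - a i (s i) = 0 :> F.
  by move=> iJ h; rewrite (bigD1 i) //= mxE (negbTE h) oppr0 mul0r mulr0.
rewrite [X in _ + X + _]big1 => [|s /andP[/andP[sJ0 _] ss0]]; last first.
  have [j sj] : exists j, s j != s0 j.
    apply/existsP; apply: contraNT ss0 => /existsPn h.
    by apply/eqP/permP => j; apply/eqP; have := h j; rewrite negbK.
  have jJ : j \in J0.
    apply: contraNT sj => jJ.
    by rewrite (out_perm sJ0 jJ) (out_perm sJ jJ).
  by apply: prod0 jJ _; rewrite (negbTE sj) andbF.
rewrite [X in _ + X]big1 => [|J /andP[JJ0 neqJ]]; last first.
  have [j jJ jJ0] : exists2 j, j \in J & j \notin J0.
    apply/fintype.subsetPn; apply: contra neqJ => sub.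
    by rewrite eqEcard sub (eqP JJ0) (eqP Jk) leqnn.
  by apply: big1 => s _; apply: prod0 jJ _; rewrite (negbTE jJ0).
rewrite !addr0 (eq_bigr (fun=> -1)) => [|i iJ]; last by rewrite mxE iJ eqxx.
by rewrite prodr_const -exprD signr_eq0.
Qed.

(** No cancellation among the terms of minimal weight: the tropical bound on the
    order of each coefficient of the characteristic polynomial is then exact. *)
Definition nondegenerate (a : 'M[R[i]]_n) : Prop :=
  forall k, (k <= n)%N ->
    minplus_char_coef A k != +oo%E -> char_coef_lead a k != 0.

(** The polynomials [char_coef_lead X k], for a matrix [X] of indeterminates,
    are multiplied over the [k] with a finite [minplus_char_coef A k]. *)
Lemma generically_nondegenerate : generically nondegenerate.
Proof.
pose X : 'M[mpoly.mpoly (n * n) R[i]]_n :=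
  \matrix_(i, j) mpoly.mpolyX _ (mpoly.mnm1 (mxvec_index i j)).
have evalX (a : 'M[R[i]]_n) k :
    mpoly.meval (fun k => mxvec a ord0 k) (char_coef_lead X k) =
    char_coef_lead a k.
  rewrite rmorph_char_coef_lead; congr char_coef_lead.
  apply/matrixP => i j; rewrite mxE [X _ _]mxE.
  exact: etrans (mpoly.mevalXU _ _) (mxvecE _ _ _).
exists (\prod_(k < n.+1 | minplus_char_coef A k != +oo%E) char_coef_lead X k).
  apply/prodf_neq0 => k /(char_coef_lead_neq0 (R[i] : comNzRingType))[a].
  by apply: contra_neq => X0; rewrite -evalX X0 rmorph0.
move=> a; rewrite rmorph_prod => /prodf_neq0 a_generic k kn Pk.
by rewrite -evalX; apply: (a_generic (Ordinal (kn : k < n.+1)%N)).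
Qed.

Definition minplus_char_eval (y : R) : \bar R :=
  \big[Order.min/+oo%E]_(k < n.+1) (minplus_char_coef A k + y%:E *+ k)%E.

Lemma minplus_char_eval_neqy y : minplus_char_eval y != +oo%E.
Proof.
rewrite -ltey /minplus_char_eval; apply: le_lt_trans (bigmin_le _ ord_max _) _ => /=.
by rewrite minplus_char_coef_n add0e -EFin_natmul ltey.
Qed.

Lemma minplus_char_eval_attained y :
  exists k : 'I_n.+1,
    minplus_char_eval y = (minplus_char_coef A k + y%:E *+ k)%E.
Proof.
by have [k _ E] := bigmin_attained (minplus_char_eval_neqy y); exists k.
Qed.

Lemma minplus_char_eval_neqNy y : minplus_mx A -> minplus_char_eval y != -oo%E.
Proof.
move=> hA; have [k ->] := minplus_char_eval_attained y.
rewrite -EFin_natmul; have := minplus_char_coef_fin k hA.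
by case: (minplus_char_coef A k).
Qed.
End LeadingCoef.

(** * Two asymptotics of the characteristic polynomial *)

Section CharPolyAsymptotics.
Variables (R : realType) (n : nat) (A : 'M[\bar R]_n).
Hypothesis hA : minplus_mx A.
Variables (a : 'M[R[i]]_n) (mA : R -> 'M[R[i]]_n).
Hypothesis mA_a : mx_asymp mA a A.

Lemma coef_char_poly_asymp k : (k <= n)%N ->
  asymp_equiv (fun e => (char_poly (mA e))`_k) (char_coef_lead A a k)
    (minplus_char_coef A k).
Proof.
move=> kn; pose b (J : {set 'I_n}) : R[i] :=
  \sum_(s : {perm 'I_n} | perm_on J s &&
        ((\sum_(i in J) A i (s i))%E == minplus_char_coef A k))
      (-1) ^+ s * \prod_(i in J) - a i (s i).
have minor (J : {set 'I_n}) : #|J| == (n - k)%N ->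
    asymp_equiv (fun e => \sum_(s : {perm 'I_n} | perm_on J s)
      (-1) ^+ s * \prod_(i in J) - mA e i (s i)) (b J) (minplus_char_coef A k).
  move=> Jk; apply: asymp_equiv_sum => [|s sJ|s sJ].
  - exact: minplus_char_coef_fin.
  - (* The sign is a constant germ, of exponent 0. *)
    rewrite -[X in asymp_equiv _ _ X]add0e.
    apply: asymp_equivM (@cst_asymp_equiv _ _) _.
    apply: asymp_equiv_prod => j _; apply: asymp_equivN.
    by have [] := mA_a j (s j).
  - exact: minplus_char_coef_le.
have := @asymp_equiv_sum R _ (index_enum {set 'I_n}) (fun J => #|J| == (n - k)%N)
  _ b (fun=> minplus_char_coef A k) (minplus_char_coef A k)
  (minplus_char_coef_fin k hA) minor (fun _ _ => lexx _).
under eq_bigl do rewrite eqxx andbT.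
move=> /asymp_equiv_near; apply; near=> e.
by rewrite coef_char_poly.
Unshelve. all: by end_near. Qed.

Lemma monomial_asymp (w : R[i]) (y : R) k :
  asymp_equiv (fun e => (w * (e `^ y)%:C%C) ^+ k) (w ^+ k) (y%:E *+ k)%E.
Proof. exact/asymp_equivX/powR_asymp_equiv. Qed.

(** The terms carried by the edge, or the vertex, at which a line of slope [- y]
    supports the Newton polygon of the points [(k, minplus_char_coef A k)]. *)
Definition edge_poly (y : R) : {poly R[i]} :=
  \sum_(k < n.+1 | (minplus_char_coef A k + y%:E *+ k)%E == minplus_char_eval A y)
    char_coef_lead A a k *: 'X^k.

Lemma char_poly_horner_asymp (y : R) (w : R[i]) :
  asymp_equiv (fun e => (char_poly (mA e)).[w * (e `^ y)%:C%C])
    (edge_poly y).[w] (minplus_char_eval A y).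
Proof.
have -> : (edge_poly y).[w] =
    \sum_(k < n.+1 | (minplus_char_coef A k + y%:E *+ k)%E == minplus_char_eval A y)
      char_coef_lead A a k * w ^+ k.
  by rewrite horner_sum; apply: eq_bigr => k _; rewrite hornerZ hornerXn.
have := @asymp_equiv_sum R _ (index_enum 'I_n.+1) predT
  (fun (k : 'I_n.+1) e => (char_poly (mA e))`_k * (w * (e `^ y)%:C%C) ^+ k)
  (fun k : 'I_n.+1 => char_coef_lead A a k * w ^+ k)
  (fun k : 'I_n.+1 => minplus_char_coef A k + y%:E *+ k)%E
  (minplus_char_eval A y) (minplus_char_eval_neqNy y hA) _ _.
move=> h; apply: asymp_equiv_near (h _ _) _ => [k _|k _|].
- apply: asymp_equivM (monomial_asymp _ _ _).
  by apply: coef_char_poly_asymp; rewrite -ltnS.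
- exact: bigmin_le.
near=> e; rewrite (@horner_coef_wide _ n.+1) //.
by rewrite size_char_poly.
Unshelve. all: by end_near. Qed.

Lemma edge_poly_neq0 y : nondegenerate A a -> edge_poly y != 0.
Proof.
move=> generic; have [k E] := minplus_char_eval_attained A y.
have kn : (k <= n)%N by rewrite -ltnS.
have Pk : minplus_char_coef A k != +oo%E.
  apply: contra_neq (minplus_char_eval_neqy A y) => Pk.
  by rewrite E Pk -EFin_natmul.
apply: contra_neq (generic k kn Pk) => edge0.
have <- : (edge_poly y)`_k = char_coef_lead A a k.
  rewrite coef_sum (bigD1 k) /=; last by rewrite E.
  rewrite coefZ coefXn eqxx mulr1 big1 ?addr0 // => j /andP[_ jk].
  by rewrite coefZ coefXn eq_sym (negbTE jk : (j == k :> nat) = false) mulr0.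
by rewrite edge0 coef0.
Qed.

Variables (L : 'I_n -> R -> R[i]) (lambda : 'I_n -> R[i]).
Variable Lambda : n.-tuple (\bar R).
Hypothesis eigL : eigenvalue_germs mA L.
Hypothesis L_lambda :
  forall i, first_order_asymp (L i) (lambda i) (tnth Lambda i).

(** The coefficient of [w * e `^ y - L i e] at the exponent
    [Order.min y%:E (tnth Lambda i)], as a polynomial in [w]. *)
Definition eigen_factor (y : R) (i : 'I_n) : {poly R[i]} :=
  (if y%:E == Order.min y%:E (tnth Lambda i) then 'X else 0) -
  (if tnth Lambda i == Order.min y%:E (tnth Lambda i) then lambda i else 0)%:P.

Lemma tnth_Lambda_fin i : tnth Lambda i != -oo%E.
Proof. by have [_ _ /asymp_equiv_minplus] := L_lambda i. Qed.

Lemma sum_min_exponents_fin y :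
  (\sum_(i < n) Order.min y%:E (tnth Lambda i))%E \is a fin_num.
Proof.
rewrite -(big_tuple _ _ Lambda predT); apply: sum_min_fin_num.
by apply/tnthP => -[j E]; have := tnth_Lambda_fin j; rewrite -E.
Qed.

Lemma eigen_factor_neq0 y i : eigen_factor y i != 0.
Proof.
rewrite /eigen_factor; have [_ l0 _] := L_lambda i.
case: ifPn => [_|yL].
  by rewrite -size_poly_gt0 size_XsubC.
rewrite sub0r oppr_eq0 polyC_eq0.
move: yL; case: leP => [|Ly]; rewrite ?eqxx // => _.
by apply: l0; rewrite -ltey (lt_trans Ly) // ltey.
Qed.

Lemma eigen_prod_asymp (y : R) (w : R[i]) :
  asymp_equiv (fun e => (char_poly (mA e)).[w * (e `^ y)%:C%C])
    (\prod_i eigen_factor y i).[w]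
    (\sum_(i < n) Order.min y%:E (tnth Lambda i))%E.
Proof.
have [_ eigE] := eigL; rewrite horner_prod.
have factor j : asymp_equiv (fun e => w * (e `^ y)%:C%C - L j e)
    (eigen_factor y j).[w] (Order.min y%:E (tnth Lambda j)).
  have minfin : Order.min y%:E (tnth Lambda j) != -oo%E.
    by case: leP => _ //; exact: tnth_Lambda_fin.
  rewrite /eigen_factor hornerD hornerN hornerC.
  rewrite (_ : horner _ w =
    if y%:E == Order.min y%:E (tnth Lambda j) then w else 0); last first.
    by case: ifP => _; rewrite ?hornerX ?horner0.
  apply: asymp_equivD; last apply: asymp_equivN.
    apply: asymp_equiv_le (@powR_asymp_equiv _ _ _) minfin _.
    by rewrite ge_min lexx.
  have [_ _ Lj] := L_lambda j.
  by apply: asymp_equiv_le Lj minfin _; rewrite ?ge_min ?lexx ?orbT.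
apply: asymp_equiv_near (asymp_equiv_prod _ (fun j _ => factor j)) _.
near=> e; rewrite (near eigE e) // horner_prod.
by apply: eq_bigr => j _; rewrite hornerXsubC.
Unshelve. all: by end_near. Qed.

Lemma minplus_char_eval_le_exponents y :
  (minplus_char_eval A y <= \sum_(i < n) Order.min y%:E (tnth Lambda i))%E.
Proof.
have /closed_nonrootP[w w0] : \prod_i eigen_factor y i != 0.
  by apply/prodf_neq0 => j _; exact: eigen_factor_neq0.
apply: asymp_equiv_exponent_le w0 _.
- exact: char_poly_horner_asymp.
- exact: eigen_prod_asymp.
- by have := sum_min_exponents_fin y; rewrite fin_numE => /andP[].
Qed.

Lemma exponents_le_minplus_char_eval y :
  nondegenerate A a ->
  (\sum_(i < n) Order.min y%:E (tnth Lambda i) <= minplus_char_eval A y)%E.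
Proof.
move=> /edge_poly_neq0 - /(_ y)/closed_nonrootP[w w0].
apply: asymp_equiv_exponent_le w0 (minplus_char_eval_neqy A y).
- exact: eigen_prod_asymp.
- exact: char_poly_horner_asymp.
Qed.
End CharPolyAsymptotics.

Theorem theorem3p8 (R : realType) (n : nat) (A : 'M[\bar R]_n)
    (Gamma : n.-tuple (\bar R))
    (hA : minplus_mx A)
    (hirr : minplus_irreducible A)
    (hGamma : minplus_roots (minplus_char_coef A) Gamma) :
  (forall (a : 'M[R[i]]_n) (mA : R -> 'M[R[i]]_n) (L : 'I_n -> R -> R[i])
      (lambda : 'I_n -> R[i]) (Lambda : n.-tuple (\bar R)),
      mx_asymp mA a A ->
      eigenvalue_germs mA L ->
      (forall i, first_order_asymp (L i) (lambda i) (tnth Lambda i)) ->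
      weak_supermajorized Lambda Gamma)
  /\
  generically (fun a : 'M[R[i]]_n =>
    forall (mA : R -> 'M[R[i]]_n) (L : 'I_n -> R -> R[i])
      (lambda : 'I_n -> R[i]) (Lambda : n.-tuple (\bar R)),
      mx_asymp mA a A ->
      eigenvalue_germs mA L ->
      (forall i, first_order_asymp (L i) (lambda i) (tnth Lambda i)) ->
      sort <=%O Lambda = Gamma :> seq (\bar R)).
Proof.
have [sGamma Gamma_fin rootsE] := hGamma.
have Gamma_noNy : -oo%E \notin (Gamma : seq _).
  by apply/tnthP => -[j E]; have := Gamma_fin j; rewrite /minplus -E.
have evalE y : minplus_char_eval A y = (\sum_(x <- Gamma) Order.min y%:E x)%E.
  by rewrite /minplus_char_eval rootsE // minplus_char_coef_n add0e big_tuple.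
have sumE (Lambda : n.-tuple (\bar R)) y :
    (\sum_(i < n) Order.min y%:E (tnth Lambda i) =
     \sum_(x <- sort <=%O Lambda) Order.min y%:E x)%E.
  rewrite -(big_tuple _ _ Lambda predT).
  by apply: perm_big; rewrite perm_sym perm_sort.
have major a mA L lambda (Lambda : n.-tuple (\bar R)) : mx_asymp mA a A ->
    eigenvalue_germs mA L ->
    (forall i, first_order_asymp (L i) (lambda i) (tnth Lambda i)) ->
    forall k, (k <= n)%N -> (\sum_(x <- take k Gamma) x <=
      \sum_(x <- take k (sort <=%O Lambda)) x)%E.
  move=> mA_a eigL L_lambda k kn; apply: prefix_sum_le => //.
  - by rewrite size_sort !size_tuple.
  - by rewrite size_tuple.
  move=> y; rewrite -evalE -sumE.
  exact: minplus_char_eval_le_exponents L_lambda y.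
split=> [a mA L lambda Lambda mA_a eigL L_lambda k /andP[_ kn]|].
  rewrite (sorted_sort le_trans sGamma).
  exact: major L_lambda k kn.
have [p p0 p_generic] := generically_nondegenerate A.
exists p => // a /p_generic generic mA L lambda Lambda mA_a eigL L_lambda.
have sL : sorted <=%O (sort <=%O Lambda) := sort_le_sorted _.
have Lambda_noNy : -oo%E \notin sort <=%O Lambda.
  rewrite mem_sort; apply/tnthP => -[j E].
  by have := tnth_Lambda_fin L_lambda j; rewrite -E.
have szL : size (sort <=%O Lambda) = size Gamma by rewrite size_sort !size_tuple.
apply: prefix_sum_inj => // k; rewrite size_tuple => kn; apply: le_anti.
rewrite (major _ _ _ _ _ mA_a eigL L_lambda) //=.
apply: prefix_sum_le => //; first by rewrite szL size_tuple.
move=> y; rewrite -evalE -sumE.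
exact: exponents_le_minplus_char_eval L_lambda y generic.
Qed.
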